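(* Let $C$ be a smooth projective geometrically connected curve over a finite field $\mathbb{F}_q$ with function field $F$ and Weil group $W_F$, let $G$ be a semi-simple simply-connected group with Langlands dual group ${}^LG$ (of adjoint type), and let $\sigma:W_F\to{}^LG$ be an unramified $\ell$-adic homomorphism such that the centralizer $\Gamma$ of its image in ${}^LG$ is finite. For $\gamma\in\Gamma$ let $\sigma_\gamma:W_F\to{}^LG$ be the homomorphism $\sigma_\gamma(g)=\sigma(g)\alpha_\gamma(g)$, where $\alpha_\gamma:W_F\to\Gamma$ is the composition of $\mathrm{res}:W_F\to W_{\mathbb{F}_q}=\mathbb{Z}$ with the homomorphism $\mathbb{Z}\to\Gamma$, $1\mapsto\gamma$. Suppose that for every conjugacy class $[\gamma]$ of $\Gamma$ a Hecke eigenfunction $\widehat f_{[\gamma]}$ with respect to $\sigma_\gamma$ on $G(F)\backslash G(\mathbb{A}_F)/G(\mathcal{O}_F)$ is given (the equivalence class of $\sigma_\gamma$ depends only on $[\gamma]$). For each finite-dimensional representation $R$ of $\Gamma$ put $$f_R=\frac{1}{|\Gamma|}\sum_{\gamma\in\Gamma}\mathrm{Tr}(\gamma,R)\,\widehat f_{[\gamma]}.$$ Then for every finite-dimensional representation $V$ of ${}^LG$, every $x\in C(\mathbb{F}_q)$ and every irreducible representation $R$ of $\Gamma$, $$T_{V,x}\cdot f_R=\sum_{R'\in\mathrm{Irrep}(\Gamma)}\mathrm{Tr}\big(\sigma(\mathrm{Fr}_x),V(R')\big)\,f_{R\otimes R'},$$ and moreover $$\sum_{R\in\mathrm{Irrep}(\Gamma)}\dim(R)\,f_R=\widehat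 f_{[1]},$$ a Hecke eigenfunction with respect to $\sigma$.
   Context: Representations and functions have values in $\overline{\mathbb{Q}}_\ell$, $\ell\nmid q$. $\mathbb{A}_F$ is the ring of adeles of $F$ and $\mathcal{O}_F=\prod_x\mathcal{O}_x$. $T_{V,x}$ denotes the spherical Hecke operator at the closed point $x$ corresponding to the class of $V$ under the Satake isomorphism between the spherical Hecke algebra at $x$ and the representation ring of ${}^LG$ (normalized so as to ignore powers of $q$). A Hecke eigenfunction with respect to an unramified $\tau:W_F\to{}^LG$ is a function $h$ with $T_{V,x}\cdot h=\mathrm{Tr}(\tau(\mathrm{Fr}_x),V)\,h$ for all $V$ and all closed points $x$, where $\mathrm{Fr}_x$ is the Frobenius conjugacy class at $x$. The map $\mathrm{res}$ is restriction to the scalars $\overline{\mathbb{F}}_q$, with $\mathrm{res}(\mathrm{Fr}_x)=1$ for $x\in C(\mathbb{F}_q)$. $\mathrm{Irrep}(\Gamma)$ is the set of isomorphism classes of irreducible representations of $\Gamma$. For a representation $V$ of ${}^LG$, write $V=\bigoplus_{R'\in\mathrm{Irrep}(\Gamma)}V(R')\otimes R'$ for its isotypic decomposition under $\Gamma$, so that $V(R')=\mathrm{Hom}_\Gamma(R',V)$ is a representation of the centralizer of $\Gamma$ in ${}^LG$; since $\sigma$ takes values in this centralizer, $\mathrm{Tr}(\sigma(\mathrm{Fr}_x),V(R'))$ is well defined. The function $f_{R\otimes R'}$ equals $\sum_{R''}m_{R''}f_{R''}$ if $R\otimes R'\cong\bigoplus_{R''}(R'')^{\oplus m_{R''}}$.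 *)

(* Defs.v *)
From HB Require Import structures.
From mathcomp Require Import all_boot all_order all_algebra all_fingroup.
From mathcomp Require Import all_field all_character.
From mathcomp Require Import finmap all_classical.
From mathcomp Require mpoly.

Set Implicit Arguments.
Unset Strict Implicit.
Unset Printing Implicit Defensive.

Import Order.TTheory GRing.Theory Num.Theory.

Local Open Scope classical_set_scope.
Local Open Scope ring_scope.

Record valring (F : fieldType) := Valring {
  vring :> F -> Prop;
  vring1 : vring 1;
  vringB : forall a b, vring a -> vring b -> vring (a - b);
  vringM : forall a b, vring a -> vring b -> vring (a * b);
  vringV : forall a, vring a \/ vring a^-1;
  vring_proper : exists a, ~ vring a }.

HB.instance Definition _ (F : fieldType) := gen_eqMixin (valring F).
HB.instance Definition _ (F : fieldType) := gen_choiceMixin (valring F).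

Definition vmax (F : fieldType) (O : valring F) : set F :=
  [set a | O a /\ (a = 0 \/ ~ O a^-1)].

(* Cardinality of the residue field (0 if it is infinite). *)
Definition rescard (F : fieldType) (O : valring F) : nat :=
  #|` fset_set [set [set b | vmax O (b - a)] | a in O] |.

(* The completion of F at a discrete valuation ring O of F: a complete       *)
(* discretely valued field in which F is dense, with O the trace on F of its *)
(* valuation ring. Smallness is measured by the fractional ideals cring * c. *)
Record completion (F : fieldType) (O : set F) := Completion {
  cfield :> fieldType;
  cemb : {rmorphism F -> cfield};
  cring : valring cfield;
  cring_trace : forall a, cring (cemb a) <-> O a;
  cdense : forall y c : cfield, c != 0 ->
    exists a, cring ((y - cemb a) / c);
  ccomplete : forall u : nat -> cfield,
    (forall c, c != 0 -> exists M, forall m n, (M <= m)%N -> (M <= n)%N ->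
       cring ((u m - u n) / c)) ->
    exists l, forall c, c != 0 -> exists M, forall n, (M <= n)%N ->
       cring ((u n - l) / c) }.

(* The function fields of smooth projective geometrically connected curves   *)
(* over k: finite extensions of k(t), t transcendental, in which k is        *)
(* algebraically closed. The closed points of the curve are the proper       *)
(* valuation rings of F; these contain k because k is finite.                *)
Definition function_field (k : finFieldType) (F : fieldType)
    (i : {rmorphism k -> F}) : Prop :=
  (forall y, algebraicOver i y -> exists c, y = i c) /\
  exists t, ~ algebraicOver i t /\
    exists b : seq F, forall y, exists p s : nat -> {poly k},
      y = \sum_(j < size b)
            (map_poly i (p j)).[t] / (map_poly i (s j)).[t] * b`_j.

Definition algebraic_closure (F : fieldType) (K : closedFieldType)
    (i : {rmorphism F -> K}) : Prop :=
  forall y, algebraicOver i y.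

Definition separable_closure (F Fs : fieldType) (e : {rmorphism F -> Fs}) :
    Prop :=
  (forall y, exists p : {poly F},
     [/\ p != 0, separable_poly p & root (map_poly e p) y]) /\
  (forall p : {poly Fs}, separable_poly p -> (1 < size p)%N ->
     exists y, root p y).

Section WeilGroup.
Variables (k : finFieldType) (F Fs : fieldType).
Variables (i : {rmorphism k -> F}) (e : {rmorphism F -> Fs}).

(* w acts on the algebraic closure of k in Fs as the n-th power of the       *)
(* Frobenius a |-> a ^ #|k|; the two exponents only serve to allow n < 0.    *)
Definition frob_pow (w : Fs -> Fs) (n : int) : Prop :=
  exists m1 m2 : nat, n = m1%:Z - m2%:Z /\
    forall a, algebraicOver (e \o i) a ->
      w a ^+ (#|k| ^ m2) = a ^+ (#|k| ^ m1).

(* W_F, as the fibre product of Gal(Fs/F) and Z over Gal of the constants;   *)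
(* weil_res is the restriction map to the Weil group Z of k.                 *)
Record weil := Weil {
  weil_fun :> Fs -> Fs;
  weil_inv : Fs -> Fs;
  weil_res : int;
  weilB : {morph weil_fun : a b / a - b};
  weilM : {morph weil_fun : a b / a * b};
  weil_funK : cancel weil_fun weil_inv;
  weil_invK : cancel weil_inv weil_fun;
  weilF : forall a, weil_fun (e a) = e a;
  weil_frob : frob_pow weil_fun weil_res }.

Lemma weil_eq (u v : weil) :
  weil_fun u = weil_fun v -> weil_res u = weil_res v -> u = v.
Proof.
case: u v => [f f' m fB fM fK f'K fF fr] [g g' n gB gM gK g'K gF gr] /=.
move=> fg mn; subst g n.
have f'g' : f' = g' by apply/funext => y; rewrite -{1}[y]g'K fK.
move: gK g'K; rewrite -f'g' => gK g'K.
rewrite (Prop_irrelevance fB gB) (Prop_irrelevance fM gM).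
rewrite (Prop_irrelevance fK gK) (Prop_irrelevance f'K g'K).
by rewrite (Prop_irrelevance fF gF) (Prop_irrelevance fr gr).
Qed.

HB.instance Definition _ := gen_eqMixin weil.
HB.instance Definition _ := gen_choiceMixin weil.

Lemma weil_alg (f : Fs -> Fs) : {morph f : a b / a - b} ->
  {morph f : a b / a * b} -> (forall a, f (e a) = e a) ->
  forall a, algebraicOver (e \o i) a -> algebraicOver (e \o i) (f a).
Proof.
move=> fB fM fF a [p p0 /rootP pa]; exists p => //; apply/rootP.
have f0 : f 0 = 0 by rewrite -[X in f X](rmorph0 e) fF rmorph0.
have fD : {morph f : x y / x + y}.
  have fN x : f (- x) = - f x by rewrite -[- x]sub0r fB f0 sub0r.
  by move=> x y; rewrite -[y in LHS]opprK fB fN opprK.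
rewrite -f0 -pa; elim/poly_ind: {p0 pa} p => [|p c IH].
  by rewrite !rmorph0 !horner0 f0.
by rewrite !rmorphD !rmorphM /= !map_polyX !map_polyC /= !hornerE IH fD fM fF.
Qed.

Fact weil1_frob : frob_pow idfun 0.
Proof. by exists 0%N, 0%N; split => // a _; rewrite !expn0. Qed.

Definition weil_one : weil.
Proof. by apply: (@Weil idfun idfun 0) => //; apply: weil1_frob. Defined.

Fact weil_mul_frob (u v : weil) :
  frob_pow (u \o v) (weil_res u + weil_res v).
Proof.
have [m1 [m2 [-> um]]] := weil_frob u.
have [n1 [n2 [-> vn]]] := weil_frob v.
exists (m1 + n1)%N, (m2 + n2)%N; split.
  by rewrite !PoszD opprD addrACA.
move=> a aP /=; rewrite expnD exprM um; last first.
  exact: (weil_alg (@weilB v) (@weilM v) (@weilF v)).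
by rewrite -exprM mulnC exprM vn // -exprM -expnD addnC.
Qed.

Definition weil_mul (u v : weil) : weil.
Proof.
apply: (@Weil (u \o v) (weil_inv v \o weil_inv u) (weil_res u + weil_res v)).
- by move=> a b /=; rewrite !weilB.
- by move=> a b /=; rewrite !weilM.
- exact: can_comp (@weil_funK u) (@weil_funK v).
- exact: can_comp (@weil_invK v) (@weil_invK u).
- by move=> a /=; rewrite !weilF.
- exact: weil_mul_frob.
Defined.

Fact weilVB (u : weil) : {morph weil_inv u : a b / a - b}.
Proof. by move=> a b; apply: (can_inj (@weil_funK u)); rewrite weilB !weil_invK. Qed.
Fact weilVM (u : weil) : {morph weil_inv u : a b / a * b}.
Proof. by move=> a b; apply: (can_inj (@weil_funK u)); rewrite weilM !weil_invK. Qed.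
Fact weilVF (u : weil) a : weil_inv u (e a) = e a.
Proof. by rewrite -[e a in LHS](weilF u) weil_funK. Qed.

Fact weil_inv_frob (u : weil) : frob_pow (weil_inv u) (- weil_res u).
Proof.
have [m1 [m2 [-> um]]] := weil_frob u.
exists m2, m1; rewrite opprB; split=> // a aP.
rewrite -um; last exact: (weil_alg (@weilVB u) (@weilVM u) (@weilVF u)).
by rewrite weil_invK.
Qed.

Definition weil_invg (u : weil) : weil.
Proof.
apply: (@Weil (weil_inv u) u (- weil_res u)).
- exact: weilVB.
- exact: weilVM.
- exact: weil_invK.
- exact: weil_funK.
- exact: weilVF.
- exact: weil_inv_frob.
Defined.

Fact weil_mulA : associative weil_mul.
Proof. by move=> u v w; apply: weil_eq => //=; rewrite addrA. Qed.
Fact weil_mul1 : left_id weil_one weil_mul.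
Proof. by move=> u; apply: weil_eq => //=; rewrite add0r. Qed.
Fact weil_1mul : right_id weil_one weil_mul.
Proof. by move=> u; apply: weil_eq => //=; rewrite addr0. Qed.
Fact weil_mulV : left_inverse weil_one weil_invg weil_mul.
Proof.
by move=> u; apply: weil_eq => /=; [apply/funext/weil_funK | rewrite addNr].
Qed.
Fact weil_Vmul : right_inverse weil_one weil_invg weil_mul.
Proof.
by move=> u; apply: weil_eq => /=; [apply/funext/weil_invK | rewrite addrN].
Qed.

HB.instance Definition _ :=
  isGroup.Build weil weil_mulA weil_mul1 weil_1mul weil_mulV weil_Vmul.

Definition decomposition (x : valring F) (P : valring Fs) (w : weil) : Prop :=
  (forall a, P (e a) <-> x a) /\ (forall a, P (w a) <-> P a).

Definition inertia (x : valring F) : set weil :=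
  [set w | exists P, decomposition x P w /\
     forall a, P a -> vmax P (w a - a)].

(* The Frobenius conjugacy class at x: all (arithmetic) Frobenius elements,  *)
(* for all choices of a place over x, and up to inertia.                     *)
Definition frobenius (x : valring F) : set weil :=
  [set w | exists P, decomposition x P w /\
     forall a, P a -> vmax P (w a - a ^+ rescard x)].

End WeilGroup.

Section LinearGroups.
Variable n : nat.

Definition mxeval (R S : nzRingType) (f : R -> S) (M : 'M[S]_n)
    (p : mpoly.mpoly (n * n) R) : S :=
  mpoly.mmap f (fun j => mxvec M 0 j) p.

Definition zero_locus (k K : fieldType) (f : k -> K)
    (I : set (mpoly.mpoly (n * n) k)) : set 'M[K]_n :=
  [set M | M \in unitmx /\ forall p, I p -> mxeval f M p = 0].

Variable K : fieldType.
Implicit Types Z S : set 'M[K]_n.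

Definition zclosed Z : Prop := exists I, Z = zero_locus idfun I.

Definition subgroup Z : Prop :=
  [/\ forall M, Z M -> M \in unitmx, Z 1%:M,
      forall M N, Z M -> Z N -> Z (M *m N) & forall M, Z M -> Z (invmx M)].

Definition zconnected Z : Prop := forall Z1 Z2, zclosed Z1 -> zclosed Z2 ->
  Z = Z1 `|` Z2 -> Z1 `&` Z2 = set0 -> Z1 = set0 \/ Z2 = set0.

Definition solvable_group Z : Prop :=
  exists (m : nat) (D : nat -> set 'M[K]_n),
    [/\ D 0%N = Z, D m = [set 1%:M], forall j, subgroup (D j) &
        forall j M N, D j M -> D j N ->
          D j.+1 (M *m N *m invmx M *m invmx N)].

Definition normal_in S Z : Prop :=
  S `<=` Z /\ forall M N, Z M -> S N -> S (M *m N *m invmx M).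

Definition semisimple Z : Prop :=
  [/\ zclosed Z, subgroup Z, zconnected Z &
      forall S, zclosed S -> subgroup S -> zconnected S -> normal_in S Z ->
        solvable_group S -> S = [set 1%:M]].

Definition torus S : Prop :=
  [/\ zclosed S, subgroup S, zconnected S &
      exists2 P : 'M[K]_n, P \in unitmx &
        forall M, S M -> is_diag_mx (P *m M *m invmx P)].

Definition maximal_torus S Z : Prop :=
  [/\ torus S, S `<=` Z &
      forall S', torus S' -> S' `<=` Z -> S `<=` S' -> S' = S].

Definition regular_fun Z (f : 'M[K]_n -> K) : Prop :=
  exists p (d : nat), forall M, Z M -> f M = mxeval idfun M p / \det M ^+ d.

(* Tangent space at 1: p (1 + X * eps) = 0 modulo eps ^ 2 for every p        *)
(* vanishing on Z.                                                           *)
Definition lie_algebra Z : set 'M[K]_n :=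
  [set X | forall p, (forall M, Z M -> mxeval idfun M p = 0) ->
     (mxeval polyC (1%:M + 'X *: map_mx polyC X) p)`_1 = 0].

End LinearGroups.

(* A linear algebraic group over k together with a split torus of rank r,   *)
(* diagonal in the chosen embedding in GL_n. The torus is parametrized by    *)
(* t = (t_1, ..., t_r) |-> diag (prod_j t_j ^ A_ji)_i, so that both its      *)
(* character and cocharacter lattices are identified with Z^r, with the      *)
(* standard pairing.                                                         *)
Record lingroup (k : fieldType) (r : nat) := Lingroup {
  gdim : nat;
  geqs : set (mpoly.mpoly (gdim * gdim) k);
  gtor : 'M[int]_(r, gdim) }.
Arguments geqs {k r} l _.

Definition pairing (r : nat) (a b : 'rV[int]_r) : int := (a *m b^T) 0 0.

Section RootDatum.
Variables (r : nat) (k : fieldType) (G : lingroup k r).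

Definition gpoints (K : fieldType) (f : k -> K) : set 'M[K]_(gdim G) :=
  zero_locus f (geqs G).
Arguments gpoints : clear implicits.
Arguments gpoints {K} f _.

Variable K : fieldType.
Implicit Type t : 'rV[K]_r.

Definition tunit t : Prop := forall j, t 0 j != 0.

Definition tchar (a : 'rV[int]_r) t : K := \prod_j t 0 j ^ a 0 j.

Definition tmx t : 'M[K]_(gdim G) :=
  diag_mx (\row_l \prod_j t 0 j ^ gtor G j l).

Definition cochar (a : 'rV[int]_r) (s : K) : 'M[K]_(gdim G) :=
  tmx (\row_j s ^ a 0 j).

Variable f : k -> K.

Definition split_semisimple : Prop :=
  [/\ semisimple (gpoints f),
      exists B, gtor G *m B = 1%:M &
      maximal_torus [set tmx t | t in tunit] (gpoints f)].

Definition roots : set 'rV[int]_r :=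
  [set a | a != 0 /\ exists X, [/\ X != 0, lie_algebra (gpoints f) X &
     forall t, tunit t -> tmx t *m X *m invmx (tmx t) = tchar a t *: X]].

Definition mx2 (a b c d : K) : 'M[K]_2 :=
  \matrix_(i, j) if i == 0 then (if j == 0 then a else b)
                 else (if j == 0 then c else d).

(* b is the coroot of the root a: there is phi : SL_2 -> G carrying the       *)
(* upper and lower unipotents to the root groups of a and - a, and whose     *)
(* restriction to the diagonal is b.                                         *)
Definition coroot (a b : 'rV[int]_r) : Prop :=
  roots a /\ exists phi : 'M[K]_2 -> 'M[K]_(gdim G),
  [/\ forall i j, regular_fun [set M | \det M = 1] (fun M => phi M i j),
      forall M N, \det M = 1 -> \det N = 1 ->
        gpoints f (phi M) /\ phi (M *m N) = phi M *m phi N,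
      forall s, s != 0 -> phi (mx2 s 0 0 s^-1) = cochar b s,
      exists s, phi (mx2 1 s 0 1) != 1%:M &
      forall t s, tunit t ->
        tmx t *m phi (mx2 1 s 0 1) *m invmx (tmx t)
          = phi (mx2 1 (tchar a t * s) 0 1) /\
        tmx t *m phi (mx2 1 0 s 1) *m invmx (tmx t)
          = phi (mx2 1 0 ((tchar a t)^-1 * s) 1)].

(* The cocharacter lattice is spanned by the coroots. *)
Definition simply_connected : Prop :=
  forall l : 'rV[int]_r, exists s : seq (int * 'rV[int]_r),
    (forall cb, cb \in s -> exists a, coroot a cb.2) /\
    l = \sum_(cb <- s) cb.2 *~ cb.1.

(* A regular cocharacter mu determines a Borel subgroup containing the torus: *)
(* its roots are those that are positive on mu.                              *)
Definition regular_cochar (mu : 'rV[int]_r) : Prop :=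
  forall a, roots a -> pairing a mu != 0.

Definition two_rho (mu l : 'rV[int]_r) : int :=
  \sum_(a \in [set a | roots a /\ 0 < pairing a mu]) pairing a l.

(* K-points of the unipotent radical of that Borel subgroup: the g with      *)
(* mu(t) g mu(t)^-1 -> 1 as t -> 0.                                          *)
Definition unip_points (mu : 'rV[int]_r) : set 'M[K]_(gdim G) :=
  [set g | gpoints f g /\ forall i j,
     (mu *m gtor G) 0 i <= (mu *m gtor G) 0 j -> g i j = (i == j)%:R].

End RootDatum.
Arguments gpoints {r k} G {K} f _.
Arguments unip_points {r k} G {K} f mu _.

(* Both lattices of each root datum being Z^r, the root data are dual when   *)
(* exchanging roots and coroots carries one to the other.                    *)
Definition langlands_dual (r : nat) (k K L : fieldType) (f : k -> K)
    (G : lingroup k r) (LG : lingroup L r) : Prop :=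
  forall a b, coroot G f a b <-> coroot LG idfun b a.

Record algrep (n : nat) (K : fieldType) (Z : set 'M[K]_n) := Algrep {
  rdim : nat;
  rmx :> 'M[K]_n -> 'M[K]_rdim;
  rmx1 : rmx 1%:M = 1%:M;
  rmxM : forall M N, Z M -> Z N -> rmx (M *m N) = rmx M *m rmx N;
  rmx_regular : forall i j, regular_fun Z (fun M => rmx M i j) }.

Definition lint (l : nat) : set rat := [set a | ~~ (l %| `|denq a|)%N].

(* The integral closure of Z_l in the algebraic closure of Q_l. *)
Definition lbar_int (l : nat) (Ql : completion (lint l)) (Qb : fieldType)
    (iota : Ql -> Qb) : set Qb :=
  [set y | exists p : {poly Ql},
     [/\ p \is monic, forall j, cring Ql p`_j & root (map_poly iota p) y]].

Section LadicHom.
Variables (k : finFieldType) (F Fs : fieldType).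
Variables (i : {rmorphism k -> F}) (e : {rmorphism F -> Fs}).
Variables (l : nat) (Ql : completion (lint l)) (Qb : fieldType).
Variables (iota : Ql -> Qb) (n : nat) (Z : set 'M[Qb]_n).

(* Unramified l-adic homomorphisms W_F -> Z: continuous, where a basis of    *)
(* neighbourhoods of 1 in W_F consists of the pointwise stabilizers of       *)
(* finite sets in Gal(Fs / F kbar), with matrix entries in a finite          *)
(* extension of Q_l (equivalently, in a finite-dimensional Q_l-subspace),    *)
(* and trivial on all inertia groups.                                        *)
Definition unramified_ladic (sigma : weil i e -> 'M[Qb]_n) : Prop :=
  [/\ forall w, Z (sigma w),
      {morph sigma : u v / (u * v)%g >-> u *m v},
      forall w N, exists S : seq Fs, forall u : weil i e, weil_res u = 0 ->
        (forall a, a \in S -> u a = a) ->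
        forall a b, lbar_int iota
          ((sigma (w * u)%g a b - sigma w a b) / l%:R ^+ N),
      exists s : seq Qb, forall w a b, exists c : nat -> Ql,
        sigma w a b = \sum_(j < size s) iota (c j) * s`_j &
      forall x w, inertia x w -> sigma w = 1%:M].

End LadicHom.

Section Hecke.
Variables (k : finFieldType) (F : fieldType) (i : {rmorphism k -> F}).
Variables (Fx : forall x : valring F, completion (vring x)).
Variables (kbar : fieldType) (ik : k -> kbar).
Variables (r : nat) (G : lingroup k r) (mu : 'rV[int]_r).

Local Notation n := (gdim G).
Local Notation family := (forall x : valring F, 'M[Fx x]_n).

Definition local_points (x : valring F) : set 'M[Fx x]_n :=
  gpoints G (cemb (Fx x) \o i).

Definition integral_points (x : valring F) : set 'M[Fx x]_n :=
  [set g | [/\ local_points g, forall a b, cring (Fx x) (g a b) &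
               cring (Fx x) (\det g)^-1]].
Arguments integral_points x _ : clear implicits.

Definition adelic_points : set family :=
  [set g | (forall x, local_points (g x)) /\
           finite_set [set x | ~ integral_points x (g x)]].

(* Functions on G(F) \ G(A_F) / G(O_F). Functions on G(A_F) are represented  *)
(* by functions on all families, whose values outside G(A_F) are irrelevant. *)
Definition automorphic (Qb : fieldType) (h : family -> Qb) : Prop :=
  forall (g g' : family) (c : 'M[F]_n) (u : family),
    adelic_points g -> adelic_points g' -> gpoints G i c ->
    (forall x, integral_points x (u x)) ->
    (forall x, g' x = map_mx (cemb (Fx x)) c *m g x *m u x) -> h g' = h g.

Section AtPlace.
Variable x : valring F.

Definition lcoset (y : 'M[Fx x]_n) : set 'M[Fx x]_n :=
  [set y *m u | u in integral_points x].

Definition grassmannian : set (set 'M[Fx x]_n) :=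
  [set lcoset y | y in @local_points x].

Definition coset_rep (c : set 'M[Fx x]_n) : 'M[Fx x]_n := xget 1%:M c.

Definition uniformizer : Fx x :=
  xget 1 [set p | forall a, vmax (cring (Fx x)) a <->
                            exists2 b, cring (Fx x) b & a = p * b].

Variable Qb : fieldType.

(* The spherical Hecke algebra: compactly supported G(O_x)-bi-invariant      *)
(* functions on G(F_x).                                                      *)
Definition spherical (h : 'M[Fx x]_n -> Qb) : Prop :=
  [/\ forall y, ~ local_points y -> h y = 0,
      forall u y v, integral_points x u -> integral_points x v ->
        local_points y -> h (u *m y *m v) = h y &
      finite_set [set c | grassmannian c /\ h (coset_rep c) != 0]].

(* The convolution action, int h(y) f(g y) dy with vol G(O_x) = 1. *)
Definition hecke_act (h : 'M[Fx x]_n -> Qb) (f : family -> Qb) (g : family) :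
    Qb :=
  \sum_(c \in grassmannian)
    h (coset_rep c) * f (dfwith g x (g x *m coset_rep c)).

(* The Satake transform delta_B(t)^(1/2) int_N h(t n) dn, t = l(uniformizer), *)
(* with vol N(O_x) = 1. As t n = (t n t^-1) t and delta_B(t) is equal to     *)
(* q_x^(- 2 <rho, l>), it is q_x^(- <rho, l>) times the sum of h over the    *)
(* cosets of G(O_x) meeting N(F_x) t. Since G is simply connected, <rho, l>  *)
(* is an integer and no square root of q_x is needed.                        *)
Definition satake (h : 'M[Fx x]_n -> Qb) (l : 'rV[int]_r) : Qb :=
  (rescard x)%:R ^ (- (two_rho G ik mu l %/ 2)%Z) *
  \sum_(c \in [set lcoset (u *m cochar G l uniformizer) |
               u in unip_points G (cemb (Fx x) \o i) mu])
     h (coset_rep c).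

Variables (LG : lingroup Qb r) (V : algrep (gpoints LG idfun)).

(* The element of the spherical Hecke algebra corresponding to V: its Satake *)
(* transform, an element of the group algebra of the lattice of characters   *)
(* of the torus of LG (the cocharacters of that of G), is the character of V.*)
Definition hecke_elt : 'M[Fx x]_n -> Qb :=
  xget (fun=> 0) [set h | spherical h /\ forall t : 'rV[Qb]_r, tunit t ->
    \sum_(l \in setT) satake h l * tchar l t = \tr (V (tmx LG t))].

Definition hecke_op : (family -> Qb) -> family -> Qb := hecke_act hecke_elt.

End AtPlace.

Definition hecke_eigenfunction (Fs : fieldType) (e : {rmorphism F -> Fs})
    (Qb : fieldType) (LG : lingroup Qb r)
    (tau : weil i e -> 'M[Qb]_(gdim LG)) (h : family -> Qb) : Prop :=
  automorphic h /\
  forall (V : algrep (gpoints LG idfun)) (x : valring F) (w : weil i e),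
    frobenius x w -> forall g, adelic_points g ->
      hecke_op x V h g = \tr (V (tau w)) * h g.

End Hecke.

Definition expgz (gT : finGroupType) (c : gT) (m : int) : gT :=
  match m with Posz p => (c ^+ p)%g | Negz p => (c ^- p.+1)%g end.

(* gT is identified through emb with the centralizer of the image of sigma. *)
Definition centralizer_iso (W : Type) (K : fieldType) (n : nat)
    (Z : set 'M[K]_n) (sigma : W -> 'M[K]_n) (gT : finGroupType)
    (emb : gT -> 'M[K]_n) : Prop :=
  [/\ injective emb, {morph emb : a b / (a * b)%g >-> a *m b} &
      forall M, (exists c, emb c = M) <->
        Z M /\ forall w, M *m sigma w = sigma w *m M].

Definition twist (k : finFieldType) (F Fs : fieldType)
    (i : {rmorphism k -> F}) (e : {rmorphism F -> Fs}) (K : fieldType)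
    (n : nat) (gT : finGroupType) (emb : gT -> 'M[K]_n)
    (sigma : weil i e -> 'M[K]_n) (c : gT) (w : weil i e) : 'M[K]_n :=
  sigma w *m emb (expgz c (weil_res w)).

(* Trace of f on an f-stable subspace. *)
Definition trace_on (K : fieldType) (E : vectType K) (f : E -> E)
    (U : {vspace E}) : K :=
  \sum_(j < \dim U) coord (vbasis U) j (f (vbasis U)`_j).

Section Multiplicity.
Variables (K : fieldType) (n : nat) (Z : set 'M[K]_n) (V : algrep Z).
Variables (gT : finGroupType) (emb : gT -> 'M[K]_n).
Variables (d : nat) (R : mx_representation K [set: gT]%G d).

(* V(R) = Hom_Gamma(R, V), on which the centralizer of Gamma acts through V. *)
Definition mult_space : {vspace 'M[K]_(rdim V, d)} :=
  (\bigcap_(c : gT) lker (linfun (mulmx (V (emb c)) \- mulmxr (R c))))%VS.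

Definition mult_trace (s : 'M[K]_n) : K :=
  trace_on (mulmx (V s) : 'M[K]_(rdim V, d) -> 'M[K]_(rdim V, d)) mult_space.

End Multiplicity.

(* The function f_R, for any finite-dimensional representation R. *)
Definition endo_fun (K : fieldType) (X : Type) (gT : finGroupType)
    (fhat : {set gT} -> X -> K) (d : nat)
    (R : mx_representation K [set: gT]%G d) (g : X) : K :=
  #|gT|%:R^-1 * \sum_(c : gT) \tr (R c) * fhat (c ^: [set: gT]%G)%g g.

(* Main.v *)
Require Import Defs.
From HB Require Import structures.
From mathcomp Require Import all_boot all_order all_algebra all_fingroup.
From mathcomp Require Import all_solvable all_field all_character.
From mathcomp Require Import finmap all_classical.
From mathcomp Require Import zify ring.

Set Implicit Arguments.
Unset Strict Implicit.
Unset Printing Implicit Defensive.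

Import Order.TTheory GRing.Theory Num.Theory.

Local Open Scope classical_set_scope.
Local Open Scope ring_scope.

(* The Hecke operator is linear, and at a rational point it multiplies        *)
(* fhat_[c] by tr V(sigma(Fr) c), since Fr restricts to 1. The class function *)
(* c |-> tr V(sigma(Fr) c) of Gamma is then expanded in irreducible           *)
(* characters: its coefficient at R' is the trace of V(sigma(Fr)) composed    *)
(* with the averaging projector of Hom(R', V) onto Hom_Gamma(R', V), which is *)
(* the trace of sigma(Fr) on V(R'). The second identity is the formula for    *)
(* the character of the regular representation.                               *)

(** By linearity ([hecke_op_lincomb]) and the eigenproperty, T_V f_R is the average over c of tr
    R(c) tr V(sigma(Fr) c) fhat_[c], since res(Fr) = 1 ([weil_res_frobenius]). [mxtrace_isotypic],
    which rests on [class_fun_irr_expansion] and [mult_traceE], turns the second trace into the sum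
    over R' of tr(sigma(Fr), V(R')) tr R'(c), and tr R(c) tr R'(c) is the trace of c on the tensor
    product. In the second identity [sum_irr_degree_mxtrace] leaves only the term c = 1. *)

Section ClosedFieldCharacters.
Variables (K : closedFieldType) (gT : finGroupType).
Local Notation G := [set: gT]%G.
Hypothesis nzG : #|gT|%:R != 0 :> K.

Lemma mxtrace_regular_reprE (x : gT) :
  \tr (regular_repr K G x) = #|gT|%:R *+ (x == 1%g).
Proof.
have [->|x1] := eqVneq x 1%g; first by rewrite repr_mx1 mxtrace1 /gcard cardsT.
rewrite mulr0n /mxtrace big1 // => j _.
rewrite !mxE /=; case: eqP => // /(congr1 enum_val).
rewrite gring_indexK ?inE // => /eqP; rewrite -{1}[enum_val j]mulg1.
by rewrite (inj_eq (mulgI _)) eq_sym (negPf x1).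
Qed.

Variable Irrep : irrType K G.

Lemma sum_irr_degree_mxtrace (x : gT) :
  \sum_(R : Irrep) (irr_degree R)%:R * \tr (irr_repr R x) =
  #|gT|%:R *+ (x == 1%g).
Proof.
rewrite -mxtrace_regular_reprE (mxtrace_regular_pchar Irrep) ?inE //.
- by apply: eq_bigr => R _; rewrite mulr_natl.
- by rewrite /pgroup -natf_neq0_pchar cardsT.
- exact: group_closure_closed_field.
Qed.

(* By Schur, averaging R y over its conjugates gives a scalar matrix. *)
Lemma sum_mxtrace_irr_conj (R : Irrep) (y g : gT) :
  (irr_degree R)%:R * \sum_(h : gT) \tr (irr_repr R (h * y * h^-1 * g)%g) =
  #|gT|%:R * (\tr (irr_repr R y) * \tr (irr_repr R g)).
Proof.
pose A : 'M_(irr_degree R) := \sum_(h : gT) irr_repr R (h * y * h^-1)%g.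
have trA : \tr A = #|gT|%:R * \tr (irr_repr R y).
  rewrite raddf_sum -sum1_card natr_sum mulr_suml; apply: eq_bigr => h _ /=.
  rewrite mul1r -mulgA repr_mxM ?inE // mxtrace_mulC.
  by rewrite -repr_mxM ?inE // mulgKV.
have /is_scalar_mxP [a Aa] : is_scalar_mx A.
  apply: (@mx_abs_irr_cent_scalar K gT G _ (irr_repr R)).
    exact: (@group_closure_closed_field K gT G _ _ (socle_irr R)).
  apply/centgmxP => x _; rewrite mulmx_suml mulmx_sumr.
  rewrite (reindex_inj (mulgI x)); apply: eq_bigr => h _ /=.
  by rewrite -!repr_mxM ?inE // invMg !mulgA mulgKV.
have -> : \sum_(h : gT) \tr (irr_repr R (h * y * h^-1 * g)%g) =
          \tr (A *m irr_repr R g).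
  rewrite mulmx_suml raddf_sum; apply: eq_bigr => h _.
  by rewrite /= -repr_mxM ?inE.
rewrite mulrA -trA Aa mul_scalar_mx mxtraceZ mxtrace_scalar.
by rewrite mulr_natl mulrnAl.
Qed.

(** Second orthogonality relation: the right side counts the h conjugating y to g^-1. After
    multiplication by the group order, [sum_mxtrace_irr_conj] makes the left side a sum of regular
    characters, which detect the identity. *)
Lemma sum_mxtrace_irr_mul (y g : gT) :
  \sum_(R : Irrep) \tr (irr_repr R y) * \tr (irr_repr R g) =
  \sum_(h : gT) (h * y * h^-1 * g == 1)%g%:R.
Proof.
apply: (mulfI nzG); rewrite mulr_sumr.
under eq_bigr do rewrite -sum_mxtrace_irr_conj mulr_sumr.
rewrite exchange_big mulr_sumr; apply: eq_bigr => h _ /=.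
by rewrite sum_irr_degree_mxtrace mulr_natr.
Qed.

(** Over a general closed field, c^-1 stands in for complex conjugation in the coefficients. *)
Lemma class_fun_irr_expansion (phi : gT -> K) (g : gT) :
  (forall x h : gT, phi (h^-1 * x * h)%g = phi x) ->
  phi g = \sum_(R : Irrep)
    (#|gT|%:R^-1 * \sum_(c : gT) phi c * \tr (irr_repr R c^-1%g)) *
    \tr (irr_repr R g).
Proof.
move=> phiJ; symmetry.
under eq_bigr do rewrite -mulrA mulr_suml.
rewrite -mulr_sumr exchange_big /=.
under eq_bigr => c _.
  under eq_bigr do rewrite -mulrA.
  rewrite -mulr_sumr sum_mxtrace_irr_mul mulr_sumr.
  over.
rewrite exchange_big /=.
under eq_bigr => h _.
  (* Only c = h^-1 g h solves h c^-1 h^-1 g = 1, and phi takes the value phi g there. *)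
  rewrite (bigD1 (h^-1 * g * h)%g) //= big1 => [|c /negPf ne].
    rewrite phiJ !invMg invgK !mulgA mulgV mul1g mulgK mulVg eqxx mulr1 addr0.
    over.
  case: eqP => [/eqP|]; last by rewrite mulr0.
  rewrite -eq_invg_mul !invMg !invgK => /eqP gE.
  by move: ne; rewrite -gE !mulgA mulVg mul1g mulgKV eqxx.
by rewrite sumr_const -[phi g *+ _]mulr_natl mulKf.
Qed.

End ClosedFieldCharacters.

(** * Traces on multiplicity spaces *)

(** f o P has image in U and restricts to f there, so its trace on the whole space, computed on
    elementary matrices, is the trace of f on U. *)
Lemma trace_on_proj (K : fieldType) (m d : nat) (U : {vspace 'M[K]_(m, d)})
    (f P : 'End('M[K]_(m, d))) :
  (forall v, P v \in U) -> (forall u, u \in U -> P u = u) ->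
  (forall u, u \in U -> f u \in U) ->
  trace_on f U = \sum_a \sum_b f (P (delta_mx a b)) a b.
Proof.
move=> PU Pid fU; rewrite /trace_on.
have deltaE (v : 'M[K]_(m, d)) : v = \sum_a \sum_b v a b *: delta_mx a b.
  exact: matrix_sum_delta.
transitivity (\sum_(j < \dim U) \sum_a \sum_b
    f (vbasis U)`_j a b * coord (vbasis U) j (P (delta_mx a b))).
  apply: eq_bigr => j _.
  have bU : (vbasis U)`_j \in U.
    by apply: vbasis_mem; rewrite mem_nth // size_tuple.
  rewrite -{1}(Pid _ (fU _ bU)) {1}[f _]deltaE !linear_sum.
  apply: eq_bigr => a _; rewrite !linear_sum.
  by apply: eq_bigr => b _; rewrite !linearZ.
rewrite exchange_big; apply: eq_bigr => a _ /=.
rewrite exchange_big; apply: eq_bigr => b _ /=.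
rewrite [in RHS](coord_vbasis (PU (delta_mx a b))) linear_sum summxE.
by apply: eq_bigr => j _; rewrite linearZ mxE mulrC.
Qed.

Section MultTrace.
Variables (K : fieldType) (n : nat) (Z : set 'M[K]_n) (V : algrep Z).
Variables (gT : finGroupType) (emb : gT -> 'M[K]_n).
Hypotheses (embZ : forall c, Z (emb c)) (emb1 : emb 1%g = 1%:M).
Hypothesis embM : {morph emb : a b / (a * b)%g >-> a *m b}.
Hypothesis nzG : #|gT|%:R != 0 :> K.
Variables (d : nat) (R : mx_representation K [set: gT]%G d).

Lemma mult_spaceP (M : 'M[K]_(rdim V, d)) :
  reflect (forall c, V (emb c) *m M = M *m R c) (M \in mult_space V emb R).
Proof.
rewrite memvE; apply: (iffP subv_bigcapP) => [+ c|+ c _] => /(_ c).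
  move=> /(_ isT); rewrite -memvE memv_ker lfunE /= subr_eq0.
  by move/eqP.
by rewrite -memvE memv_ker lfunE /= => ->; rewrite subrr.
Qed.

Let avg : 'End('M[K]_(rdim V, d)) :=
  #|gT|%:R^-1 *:
    \sum_(c : gT) linfun (mulmxr (R c^-1%g) \o mulmx (V (emb c))).

Let avgE M :
  avg M = #|gT|%:R^-1 *: \sum_(c : gT) V (emb c) *m M *m R c^-1%g.
Proof.
rewrite scale_lfunE sum_lfunE; congr (_ *: _).
by apply: eq_bigr => c _; rewrite lfunE.
Qed.

(** [trace_on_proj] applies to the averaging projector [avg], and M |-> A M B has trace tr A tr
    B. *)
Lemma mult_traceE (s : 'M[K]_n) :
  Z s -> (forall c, emb c *m s = s *m emb c) ->
  mult_trace V emb R s =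
  #|gT|%:R^-1 * \sum_(c : gT) \tr (V (s *m emb c)) * \tr (R c^-1%g).
Proof.
move=> Zs cs.
have -> : mult_trace V emb R s =
    trace_on (linfun (mulmx (V s)) : 'End('M[K]_(rdim V, d)))
      (mult_space V emb R).
  by apply: eq_bigr => j _; rewrite lfunE.
rewrite (@trace_on_proj _ _ _ _ _ avg); first last.
- move=> M /mult_spaceP MP; apply/mult_spaceP => c; rewrite lfunE /=.
  by rewrite mulmxA -rmxM // cs rmxM // -mulmxA MP mulmxA.
- move=> M /mult_spaceP MP; rewrite avgE.
  under eq_bigr do rewrite MP -mulmxA -repr_mxM ?inE // mulgV repr_mx1 mulmx1.
  by rewrite sumr_const -scaler_nat scalerA mulVf // scale1r.
- move=> M; apply/mult_spaceP => c; rewrite avgE -scalemxAr -scalemxAl.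
  congr (_ *: _); rewrite mulmx_sumr mulmx_suml.
  rewrite [RHS](reindex_inj (mulgI c)); apply: eq_bigr => x _ /=.
  rewrite -!mulmxA -repr_mxM ?inE // invMg mulgKV embM rmxM //.
  by rewrite !mulmxA.
under eq_bigr do under eq_bigr do
  rewrite lfunE /= avgE -scalemxAr mxE mulmx_sumr summxE mulr_sumr.
rewrite mulr_sumr.
under eq_bigr do rewrite exchange_big /=.
rewrite exchange_big /=; apply: eq_bigr => c _.
rewrite {1}/mxtrace mulr_suml mulr_sumr; apply: eq_bigr => a _.
rewrite {1}/mxtrace !mulr_sumr; apply: eq_bigr => b _; congr (_ * _).
(* An elementary matrix is a column times a row, so the entry factors into two diagonal entries. *)
rewrite !mulmxA -rmxM // -(mul_delta_mx (0 : 'I_1)) !mulmxA -colE -mulmxA -rowE.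
by rewrite !mxE big_ord1 !mxE.
Qed.

End MultTrace.

(** As s commutes with the image of [emb], c |-> tr V(s c) is a class function; [mult_traceE]
    identifies its coefficients. *)
Lemma mxtrace_isotypic (K : closedFieldType) (n : nat) (Z : set 'M[K]_n)
    (V : algrep Z) (gT : finGroupType) (emb : gT -> 'M[K]_n)
    (Irrep : irrType K [set: gT]%G) (s : 'M[K]_n) (g : gT) :
  (forall c, Z (emb c)) -> emb 1%g = 1%:M ->
  {morph emb : a b / (a * b)%g >-> a *m b} -> #|gT|%:R != 0 :> K ->
  Z s -> (forall M N, Z M -> Z N -> Z (M *m N)) ->
  (forall c, emb c *m s = s *m emb c) ->
  \tr (V (s *m emb g)) =
  \sum_(R : Irrep) mult_trace V emb (irr_repr R) s * \tr (irr_repr R g).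
Proof.
move=> embZ emb1 embM nzG Zs ZM cs.
pose phi c := \tr (V (s *m emb c)).
rewrite -/(phi g) (class_fun_irr_expansion nzG Irrep).
  by apply: eq_bigr => R _; rewrite mult_traceE.
move=> x h; rewrite /phi; have Zsx : Z (s *m emb x) by exact: ZM.
have -> : s *m emb (h^-1 * x * h)%g = emb h^-1%g *m (s *m emb x *m emb h).
  by rewrite !embM !mulmxA cs.
rewrite rmxM //; last exact: ZM.
rewrite mxtrace_mulC -rmxM //; last exact: ZM.
by rewrite -!mulmxA -embM mulgV emb1 mulmx1.
Qed.

(** * Frobenius elements at rational points restrict to 1 *)

Lemma pchar_nat_card (k : finFieldType) (L : fieldType) :
  {rmorphism k -> L} -> [pchar L].-nat #|k|.
Proof.
move=> f; have [p _ pk] := finPcharP k.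
have /andP[pG _] := fin_ring_pchar_abelem pk.
move: pG; rewrite /pgroup cardsT; apply: sub_in_pnat => s _ /eqP ->.
exact: rmorph_pchar f _ pk.
Qed.

Section FrobeniusRestriction.
Variables (k : finFieldType) (F Fs : fieldType).
Variables (i : {rmorphism k -> F}) (e : {rmorphism F -> Fs}).

Let q_gt1 : (1 < #|k|)%N := finRing_gt1 k.

Let qDn (m : nat) : {morph (fun a : Fs => a ^+ (#|k| ^ m)) : a b / a + b}.
Proof.
move=> a b; rewrite exprDn_pchar // pnatX.
by rewrite (pchar_nat_card (e \o i : {rmorphism k -> Fs})).
Qed.

(** X^Q - X - 1, with Q = #|k|^j, has derivative -1 as Q = 0 in [Fs], so it is separable and has a
    root. *)
Lemma exists_artin_schreier (j : nat) : separable_closure e ->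
  (0 < j)%N ->
  exists2 a : Fs, algebraicOver (e \o i) a & a ^+ (#|k| ^ j) = a + 1.
Proof.
move=> [_ closed] j_gt0; set Q := (#|k| ^ j)%N.
have Q_gt1 : (1 < Q)%N by rewrite -(exp1n j) ltn_exp2r.
have sz (L : fieldType) : size ('X^Q - ('X + 1) : {poly L}) = Q.+1.
  by rewrite size_polyDl size_polyXn // size_polyN size_XaddC.
have Q0 : Q%:R = 0 :> Fs.
  apply/eqP; rewrite -[_ == 0]negbK natf_neq0_pchar; apply/negP => Q'.
  have : [pchar Fs].-nat Q.
    by rewrite /Q pnatX (pchar_nat_card (e \o i : {rmorphism k -> Fs})).
  move=> Qp; move: (pnat_coprime Qp Q'); rewrite /coprime gcdnn.
  by rewrite gtn_eqF.
have sep : separable_poly ('X^Q - ('X + 1) : {poly Fs}).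
  rewrite separable_poly.unlock derivB derivXn derivD derivX (derivC 1).
  rewrite addr0 -mulr_natl -polyC_natr Q0 mul0r sub0r.
  rewrite -[X in coprimep _ X]scaleN1r.
  by rewrite coprimepZr ?oppr_eq0 ?oner_eq0 // coprimep1.
have [|a] := closed _ sep; first by rewrite sz; lia.
rewrite /root !hornerE subr_eq0 => /eqP aE.
exists a => //; exists ('X^Q - ('X + 1)); first by rewrite -size_poly_eq0 sz.
rewrite /root rmorphB rmorphD rmorph1 /= map_polyXn map_polyX !hornerE subr_eq0.
by rewrite aE.
Qed.

(* An Artin-Schreier root a satisfies w a = a ^+ #|k| exactly, and not only   *)
(* modulo the maximal ideal: the difference d of the two sides satisfies      *)
(* d ^+ Q = d, hence is a unit of P if it is nonzero. Moreover a separates    *)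
(* the Frobenius powers #|k| ^ m1 and #|k| ^ m2.+1.                           *)
Lemma weil_res_frobenius (x : valring F) (w : weil i e) :
  separable_closure e -> rescard x = #|k| -> frobenius x w -> weil_res w = 1.
Proof.
move=> hFs cardx [P [[_ wP]]]; rewrite cardx => wfrob.
have [m1 [m2 [-> wE]]] := weil_frob w.
suff -> : m1 = m2.+1 by rewrite -addn1 PoszD addrAC subrr add0r.
apply/eqP/negPn/negP => ne.
(* The smaller exponent and the gap between the two. *)
pose A := minn m1 m2.+1; pose j := (maxn m1 m2.+1 - A)%N.
have j_gt0 : (0 < j)%N by rewrite /j /A; move: ne; lia.
have [a alg_a aQ] := exists_artin_schreier hFs j_gt0.
set Q := (#|k| ^ j)%N in aQ.
have Q_gt1 : (1 < Q)%N by rewrite -(exp1n j) ltn_exp2r.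
have w0 : w 0 = 0 by rewrite -(rmorph0 e) weilF.
have w1 : w 1 = 1 by rewrite -(rmorph1 e) weilF.
have wN b : w (- b) = - w b by rewrite -sub0r weilB w0 sub0r.
have wD b c : w (b + c) = w b + w c by rewrite -[c in LHS]opprK weilB wN opprK.
have wX b m : w (b ^+ m) = w b ^+ m.
  by elim: m => [|m IH]; rewrite ?expr0 // !exprS weilM IH.
have PX b m : P b -> P (b ^+ m).
  move=> Pb; elim: m => [|m IH]; first exact: vring1.
  by rewrite exprS; apply: vringM.
have PN b : P b -> P (- b).
  move=> Pb; rewrite -sub0r; apply: vringB => //.
  by rewrite -(subrr 1); apply: vringB; apply: vring1.
have PD b c : P b -> P c -> P (b + c).
  by move=> Pb Pc; rewrite -[c]opprK; apply: vringB => //; apply: PN.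
have Pa : P a.
  have [//|PaV] := vringV P a.
  have [->|a0] := eqVneq a 0.
    by rewrite -(subrr 1); apply: vringB; apply: vring1.
  (* Divide a^Q = a + 1 by a^(Q-1): a is a polynomial in a^-1. *)
  suff -> : a = a^-1 ^+ (Q - 2) + a^-1 ^+ Q.-1 by apply: PD; apply: PX.
  have QE : Q = (Q - 2).+2 by lia.
  apply: (mulfI (expf_neq0 Q.-1 a0)).
  rewrite -exprSr prednK ?(ltnW Q_gt1) // aQ mulrDr -exprMn divff // expr1n.
  by rewrite [in Q.-1]QE /= exprS -mulrA -exprMn divff // expr1n mulr1.
set d := w a - a ^+ #|k|.
have dQ : d ^+ Q = d.
  have dE : d = w a + (- a ^+ #|k|) by [].
  have NQ (b : Fs) : (- b) ^+ Q = - b ^+ Q.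
    by apply/eqP; rewrite -addr_eq0 -qDn addNr expr0n gtn_eqF ?(ltnW Q_gt1).
  rewrite {1}dE qDn NQ -wX aQ wD w1 -exprM mulnC exprM aQ.
  by rewrite -[#|k|]expn1 qDn expr1n opprD addrACA subrr addr0 expn1.
have d0 : d = 0.
  have [Pd [//|PdV]] := wfrob a Pa.
  apply/eqP/negPn/negP => d0; apply: PdV; rewrite -/d.
  suff -> : d^-1 = d ^+ (Q - 2) by apply: PX.
  apply: (mulfI d0); rewrite divff // -exprS.
  apply: (mulfI d0); rewrite -exprS mulr1 -[in LHS]dQ; congr (_ ^+ _); lia.
have wa : w a = a ^+ #|k| by apply/eqP; rewrite -subr_eq0; apply/eqP.
have := wE a alg_a; rewrite wa -exprM -expnS => aE.
(* The left side is also (a + 1)^(#|k|^A) = a^(#|k|^A) + 1, whence 1 = 0. *)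
have : a ^+ (#|k| ^ (A + j)) = a ^+ (#|k| ^ A).
  have -> : (A + j = maxn m1 m2.+1)%N by rewrite /j /A; lia.
  by rewrite /A; case: (leqP m1 m2.+1).
rewrite addnC expnD exprM aQ qDn expr1n => /eqP.
by rewrite -subr_eq0 addrAC subrr add0r oner_eq0.
Qed.

End FrobeniusRestriction.

(** * Linearity of Hecke operators *)

Section HeckeLinear.
Variables (k : finFieldType) (F : fieldType) (i : {rmorphism k -> F}).
Variables (Fx : forall x : valring F, completion (vring x)).
Variables (kbar : fieldType) (ik : k -> kbar).
Variables (r : nat) (G : lingroup k r) (mu : 'rV[int]_r).
Variables (x : valring F) (Qb : fieldType).
Variables (LG : lingroup Qb r) (V : algrep (gpoints LG idfun)).

Local Notation family := (forall x : valring F, 'M[Fx x]_(gdim G)).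

(** A sum over the infinite Grassmannian is additive in the function acted on only once all summands
    are supported in one finite set. The default value of [xget], the zero function, qualifies
    too. *)
Lemma hecke_elt_finite_support :
  finite_set [set c | grassmannian (G := G) i c /\
    hecke_elt i (Fx := Fx) (x := x) ik mu V (coset_rep c) != 0].
Proof.
rewrite /hecke_elt; case: xgetP => [h _ [[] //]|_].
by rewrite [X in finite_set X](_ : _ = set0) // -subset0 => c [_]; rewrite eqxx.
Qed.

Lemma hecke_op_lincomb (I : finType) (a : Qb) (b : I -> Qb)
    (f : I -> family -> Qb) (g : family) :
  hecke_op i ik mu x V (fun g' => a * \sum_c b c * f c g') g =
  a * \sum_c b c * hecke_op i ik mu x V (f c) g.
Proof.
have opE f' : hecke_op i ik mu x V f' g =
    \sum_(c <- fset_set [set c | grassmannian (G := G) i c /\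
        hecke_elt i (Fx := Fx) (x := x) ik mu V (coset_rep c) != 0])
      hecke_elt i ik mu V (coset_rep c) *
        f' (dfwith g x (g x *m coset_rep c)).
  rewrite -fsbig_finite; last exact: hecke_elt_finite_support.
  symmetry; apply: fsbig_widen => [c []//|c].
  move=> [gc /not_andP[//|/negP/negPn/eqP h0]].
  by rewrite /= h0 mul0r.
rewrite opE; under [in RHS]eq_bigr do rewrite opE mulr_sumr.
rewrite exchange_big mulr_sumr; apply: eq_bigr => c _ /=.
rewrite mulrCA; congr (_ * _); rewrite mulr_sumr.
by apply: eq_bigr => y _; rewrite mulrCA.
Qed.

End HeckeLinear.

Lemma completion_natf_neq0 (O : set rat) (Ql : completion O) (K : fieldType)
    (iota : {rmorphism Ql -> K}) (m : nat) : (0 < m)%N -> m%:R != 0 :> K.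
Proof.
move=> m_gt0; rewrite -(rmorph_nat (iota \o cemb Ql)) fmorph_eq0.
by rewrite pnatr_eq0 -lt0n.
Qed.

(** * The centralizer of the image of sigma *)

Section Endoscopy.
Variables (W : Type) (K : fieldType) (n : nat) (Z : set 'M[K]_n).
Variables (sigma : W -> 'M[K]_n) (gT : finGroupType) (emb : gT -> 'M[K]_n).
Hypothesis emb_iso : centralizer_iso Z sigma emb.

Lemma centralizer_iso_mem (c : gT) : Z (emb c).
Proof. by have [_ _ /(_ (emb c)) [/(_ (ex_intro _ c erefl))[]]] := emb_iso. Qed.

Lemma centralizer_iso_comm (c : gT) (w : W) :
  emb c *m sigma w = sigma w *m emb c.
Proof.
by have [_ _ /(_ (emb c)) [/(_ (ex_intro _ c erefl))[_ ->]]] := emb_iso.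
Qed.

(** [emb 1] is idempotent and invertible. *)
Lemma centralizer_iso1 : Z `<=` [set M | M \in unitmx] -> emb 1%g = 1%:M.
Proof.
move=> ZU; have [_ embM _] := emb_iso.
have U1 : emb 1%g \in unitmx := ZU _ (centralizer_iso_mem 1%g).
by rewrite -[LHS](mulKmx U1) -embM mulg1 mulVmx.
Qed.

End Endoscopy.

Theorem mainTheorem4
  (* the function field F of C over k, its separable closure, its completions *)
  (k : finFieldType) (F : fieldType) (i : {rmorphism k -> F})
  (hF : function_field i)
  (Fs : fieldType) (e : {rmorphism F -> Fs}) (hFs : separable_closure e)
  (Fx : forall x : valring F, completion x)
  (kbar : closedFieldType) (ik : {rmorphism k -> kbar})
  (hkbar : algebraic_closure ik)
  (* the coefficient field, an algebraic closure of Q_l *)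
  (l : nat) (hl : prime l) (hlk : ~~ (l %| #|k|)%N)
  (Ql : completion (lint l)) (Qb : closedFieldType)
  (iota : {rmorphism Ql -> Qb}) (hQb : algebraic_closure iota)
  (* G with a split maximal torus and a Borel subgroup, and its dual group *)
  (r : nat) (G : lingroup k r) (hG : split_semisimple G ik)
  (hGsc : simply_connected G ik)
  (mu : 'rV[int]_r) (hmu : regular_cochar G ik mu)
  (LG : lingroup Qb r) (hLG : split_semisimple LG (@idfun Qb))
  (hdual : langlands_dual ik G LG)
  (* sigma, and the finite centralizer of its image *)
  (sigma : weil i e -> 'M[Qb]_(gdim LG))
  (hsigma : unramified_ladic iota (gpoints LG idfun) sigma)
  (Gamma : finGroupType) (emb : Gamma -> 'M[Qb]_(gdim LG))
  (hGamma : centralizer_iso (gpoints LG idfun) sigma emb)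
  (* irr_repr R, for R : Irrep, runs once over each class of irreducibles *)
  (Irrep : irrType Qb [set: Gamma]%G)
  (* the eigenfunctions, indexed by conjugacy classes *)
  (fhat : {set Gamma} -> (forall x : valring F, 'M[Fx x]_(gdim G)) -> Qb)
  (hfhat : forall c : Gamma,
     hecke_eigenfunction ik mu (twist emb sigma c) (fhat (c ^: [set: Gamma]%G)%g)) :
  (forall (V : algrep (gpoints LG idfun)) (x : valring F) (w : weil i e)
          (d : nat) (R : mx_representation Qb [set: Gamma]%G d),
     rescard x = #|k| -> frobenius x w -> mx_irreducible R ->
     forall g, adelic_points i g ->
       hecke_op i ik mu x V (endo_fun fhat R) g =
       \sum_(R' : Irrep) mult_trace V emb (irr_repr R') (sigma w) *
                         endo_fun fhat (prod_repr R (irr_repr R')) g) /\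
  (forall g, adelic_points i g ->
     \sum_(R : Irrep) (irr_degree R)%:R * endo_fun fhat (irr_repr R) g =
     fhat (1 ^: [set: Gamma]%G)%g g) /\
  hecke_eigenfunction ik mu sigma (fhat (1 ^: [set: Gamma]%G)%g).
Proof.
have nzG : #|Gamma|%:R != 0 :> Qb.
  by apply: (completion_natf_neq0 iota); rewrite -cardsT cardG_gt0.
have [sigmaZ _ _ _ _] := hsigma.
have Zgrp : subgroup (gpoints LG (@idfun Qb)).
  by have [[_ ? _ _] _ _] := hLG.
have [Zunit _ ZM _] := Zgrp.
have embZ := centralizer_iso_mem hGamma.
have embC := centralizer_iso_comm hGamma.
have emb1 := centralizer_iso1 hGamma Zunit.
have [_ embM _] := hGamma.
split; [|split].
- move=> V x w d R cardx frw _ g adg.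
  have resw := weil_res_frobenius hFs cardx frw.
  rewrite /endo_fun hecke_op_lincomb.
  under [RHS]eq_bigr do rewrite mulrCA mulr_sumr.
  rewrite -mulr_sumr exchange_big; congr (_ * _); apply: eq_bigr => c _ /=.
  have [_ /(_ V x w frw g adg) ->] := hfhat c.
  rewrite /twist resw /= expg1 (mxtrace_isotypic V Irrep) //.
  rewrite [in LHS]mulrC -mulrA mulr_suml; apply: eq_bigr => R' _.
  by rewrite mxtrace_prod; ring.
- move=> g _.
  rewrite /endo_fun; under eq_bigr do rewrite mulrCA mulr_sumr.
  (* With the sum over R inside, each c carries the regular character, which vanishes off c = 1 and
     cancels the factor 1/|Gamma| there. *)
  rewrite -mulr_sumr exchange_big /= (bigD1 1%g) //= [X in _ + X]big1 => [|c c1].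
    under eq_bigr do rewrite mulrA.
    by rewrite -mulr_suml sum_irr_degree_mxtrace // eqxx mulr1n addr0 mulKf.
  under eq_bigr do rewrite mulrA.
  by rewrite -mulr_suml sum_irr_degree_mxtrace // (negPf c1) mulr0n mul0r.
- have -> : sigma = twist emb sigma 1%g.
    apply/funext => w; rewrite /twist.
    have -> : expgz (1 : Gamma)%g (weil_res w) = 1%g.
      by case: (weil_res w) => m /=; rewrite expg1n ?invg1.
    by rewrite emb1 mulmx1.
  exact: hfhat.
Qed.
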